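(* Let $((F,\nu,N),[\cdot,\cdot]_{F,h},(\rho,\eta))$ be a generalized Lie algebroid, $(g,h)$ and $(\overset{*}{g},h)$ locally invertible vector bundle morphisms from $(E,\pi,M)$, respectively its dual $(E^*,\overset{*}{\pi},M)$, to $(F,\nu,N)$. Let $L$ be a Lagrange fundamental function on $(E,\pi,M)$ and $H$ its Legendre transformation. Let $\overset{*}{u}=u_as^a\in\Gamma(E^*,\overset{*}{\pi},M)$ and write $u=u^bs_b:=\Gamma(\varphi_H,\mathrm{Id}_M)(\overset{*}{u})$. If $$\Gamma((\rho,\eta)T\varphi_H,\varphi_H)(\overset{*}{u}{}^C)=\big(\Gamma(\varphi_H,\mathrm{Id}_M)(\overset{*}{u})\big)^C,$$ then $$(g^\alpha_eu^e)\circ\pi=(g^{\alpha e}u_e)\circ\overset{*}{\pi}\circ\varphi_L,$$ $$U^a(K^\gamma_a(u)\circ h\circ\pi)(\tilde g^b_\gamma\circ\pi)=\{U_a(K^{\gamma a}(\overset{*}{u})\circ h\circ\overset{*}{\pi})(\tilde g_{c\gamma}\circ\overset{*}{\pi})H^{cb}\}\circ\varphi_L-\{(\rho^i_\alpha\circ h\circ\overset{*}{\pi})((g^\alpha_eu^e)\circ\overset{*}{\pi})H_i^b\}\circ\varphi_L.$$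
   Context: Repeated indices are summed. $M,N$ are $m$-dimensional manifolds, $h:M\to N$, $\eta:N\to M$ diffeomorphisms; a generalized Lie algebroid consists of a vector bundle $(F,\nu,N)$, a vector bundle morphism $(\rho,\eta)$ from $(F,\nu,N)$ to $(TM,\tau_M,M)$ with local components $\rho^i_\alpha$ (functions on $N$), and a Lie bracket on $\Gamma(F,\nu,N)$ satisfying $[z,fw]_{F,h}=f[z,w]_{F,h}+(\Gamma(Th\circ\rho,h\circ\eta)(z)f)w$, where $\Gamma(Th\circ\rho,h\circ\eta)(z^\alpha t_\alpha)(f)=z^\alpha\rho_\alpha^i\big(\tfrac{\partial(f\circ h)}{\partial x^i}\circ h^{-1}\big)$, $(t_\alpha)$ a local frame of $F$. $(E,\pi,M)$ has rank $r$, local frame $(s_a)$, coordinates $(x^i,y^a)$, vector fields $\partial_i,\dot\partial_a$; its dual $(E^*,\overset{*}{\pi},M)$ has dual frame $(s^a)$, coordinates $(x^i,p_a)$, vector fields $\overset{*}{\partial}_i,\dot\partial^a$. $U^a$ is the local function $y^a$ on $E$ and $U_a$ the local function $p_a$ on $E^*$. $g:E\to F$ and $\overset{*}{g}:E^*\to F$ cover $h$, with components $g^\alpha_b$, $g^{\alpha b}$ (functions on $M$) and inverse matrices $\tilde g^b_\alpha$, $\tilde g_{b\alpha}$. $\Gamma(g,h)(u^as_a)=((g^\alpha_au^a)\circ h^{-1})t_\alpha$, $\Gamma(\overset{*}{g},h)(u_as^a)=((g^{\alpha a}u_a)\circ h^{-1})t_\alpha$. $K^\gamma_a(u)$ and $K^{\gamma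 a}(\overset{*}{u})$ are defined by $[\Gamma(g,h)u,\Gamma(g,h)s_a]_{F,h}=K^\gamma_a(u)t_\gamma$ and $[\Gamma(\overset{*}{g},h)\overset{*}{u},\Gamma(\overset{*}{g},h)s^a]_{F,h}=K^{\gamma a}(\overset{*}{u})t_\gamma$. $(\rho,\eta)TE\subset(h\circ\pi)^*F\oplus TE$ is the vector bundle over $E$ with local frame $\tilde\partial_\alpha=T_\alpha\oplus(\rho^i_\alpha\circ h\circ\pi)\partial_i$, $\dot{\tilde\partial}_a=0\oplus\dot\partial_a$ ($T_\alpha$ induced by $t_\alpha$); $(\rho,\eta)TE^*\subset(h\circ\overset{*}{\pi})^*F\oplus TE^*$ has local frame $\overset{*}{\tilde\partial}_\alpha=\overset{*}{T}_\alpha\oplus(\rho^i_\alpha\circ h\circ\overset{*}{\pi})\overset{*}{\partial}_i$, $\dot{\tilde\partial}{}^a=0\oplus\dot\partial^a$. Complete lifts: $$u^C=((g^\alpha_eu^e)\circ\pi)\tilde\partial_\alpha-U^a(K^\gamma_a(u)\circ h\circ\pi)(\tilde g^b_\gamma\circ\pi)\dot{\tilde\partial}_b,$$ $$\overset{*}{u}{}^C=((g^{\alpha e}u_e)\circ\overset{*}{\pi})\overset{*}{\tilde\partial}_\alpha-U_a(K^{\gamma a}(\overset{*}{u})\circ h\circ\overset{*}{\pi})(\tilde g_{b\gamma}\circ\overset{*}{\pi})\dot{\tilde\partial}{}^b.$$ A Lagrange fundamental function is $L:E\to\mathbb R$ with $L\circ u\in C^\infty(M)$ for every nonzero section $u$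 and $L\circ0\in C^0(M)$; a Hamilton fundamental function $H:E^*\to\mathbb R$ is defined by the same conditions on $E^*$. The derivatives $L_{ab}=\partial^2L/\partial y^a\partial y^b$, $H^{ab}=\partial^2H/\partial p_a\partial p_b$, $H_i^b=\partial^2H/\partial x^i\partial p_b$ are taken to exist (off the zero section). Legendre morphisms: $\varphi_L:E\to E^*$, $u^as_a(x)\mapsto u^aL_{ab}(u_x)s^b(x)$; $\varphi_H:E^*\to E$, $u_as^a(x)\mapsto u_aH^{ab}(\overset{*}{u}_x)s_b(x)$; on sections $\Gamma(\varphi_H,\mathrm{Id}_M)(\overset{*}{u})=(u_a(H^{ab}\circ\overset{*}{u}))s_b$. The Legendre transformation of $L$ is the Hamilton fundamental function given locally by $H(\overset{*}{u}_x)=u_au^a-L(u_x)$ for $\overset{*}{u}_x=u_as^a(x)$, where $u_x=u^as_a(x)$ solves $u_b=u^aL_{ab}(u_x)$, $b=1,\dots,r$. The tangent $(\rho,\eta)$-application $((\rho,\eta)T\varphi_H,\varphi_H)$ acts on sections additively by $$\Gamma((\rho,\eta)T\varphi_H,\varphi_H)(Z^\alpha\overset{*}{\tilde\partial}_\alpha)=(Z^\alpha\circ\varphi_L)\tilde\partial_\alpha+\big([(\rho^i_\alpha\circ h\circ\overset{*}{\pi})Z^\alpha H_i^b]\circ\varphi_L\big)\dot{\tilde\partial}_b,$$ $$\Gamma((\rho,\eta)T\varphi_H,\varphi_H)(Y_a\dot{\tilde\partial}{}^a)=\big((Y_aH^{ab})\circ\varphi_L\big)\dot{\tilde\partial}_b.$$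 All identities are understood where the functions involved are defined. *)

(* Defs.v *)
From HB Require Import structures.
From mathcomp Require Import all_boot all_order all_algebra.
From mathcomp Require Import all_classical all_reals all_analysis.

Set Implicit Arguments.
Unset Strict Implicit.
Unset Printing Implicit Defensive.

Import Order.TTheory GRing.Theory Num.Theory.
Import numFieldNormedType.Exports.

Local Open Scope classical_set_scope.
Local Open Scope ring_scope.

Section Manifolds.
Context {R : realType}.

(* C^oo on U: all iterated directional derivatives are differentiable on U;
   meaningful for open U. *)
Definition smooth_on (V W : normedModType R) (U : set V) (f : V -> W) : Prop :=
  forall (vs : seq V) (x : V), U x ->
    differentiable (foldr (fun v (k : V -> W) => 'D_v k) f vs) x.

Section SmoothExt.
Context {V W : normedModType R}.

Lemma derive_near_eq (f k : V -> W) (x v : V) :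
  (\forall y \near x, f y = k y) -> 'D_v f x = 'D_v k x.
Proof.
move=> fk; have fkx : f x = k x by exact: nbhs_singleton fk.
have {}fk : \forall t \near (0 : R)^',
    t^-1 *: ((f \o shift x) (t *: v) - f x) =
    t^-1 *: ((k \o shift x) (t *: v) - k x).
  have tx : (t *: v + x) @[t --> (0 : R)] --> x.
    rewrite -[X in _ --> X]add0r -(scale0r v).
    by apply: cvgD; [apply: cvgZr_tmp; exact: cvg_id|exact: cvg_cst].
  by apply: filterS (nbhs_dnbhs (tx _ fk)) => t /= ->; rewrite fkx.
rewrite /derive; congr (lim _); apply/seteqP; split; apply: near_eq_cvg => //.
by apply: filterS fk => t ->.
Qed.

Lemma differentiable_near_eq (f k : V -> W) (x : V) :
  (\forall y \near x, f y = k y) -> differentiable f x -> differentiable k x.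
Proof.
move=> fk /diff_locallyP[dfc dfx].
have fkx : f x = k x by exact: nbhs_singleton fk.
have dkx : k \o shift x = cst (k x) + 'd f x +o_ (0 : V) id.
  apply/eqaddoP => e e0; have /eqaddoP/(_ e e0) := dfx.
  have /nbhs0P := fk; apply: filterS2 => h /=.
  by rewrite [x + h]addrC -fkx !fctE /= => ->.
have kf : 'd k x = 'd f x :> (V -> W) by exact: diff_unique dkx.
by apply/diff_locallyP; rewrite kf.
Qed.

Lemma smooth_on_eq (U : set V) (f k : V -> W) : open U ->
  (forall x, U x -> f x = k x) -> smooth_on U f -> smooth_on U k.
Proof.
move=> oU fk sf vs.
suff fkU : forall x, U x -> foldr (fun v (k : V -> W) => 'D_v k) f vs x =
    foldr (fun v (k : V -> W) => 'D_v k) k vs x.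
  move=> x Ux; apply: differentiable_near_eq (sf vs x Ux).
  by apply: filterS (open_nbhs_nbhs (conj oU Ux)) => y; exact: fkU.
elim: vs => [|v vs IH] x Ux /=; first exact: fk.
apply: derive_near_eq.
by apply: filterS (open_nbhs_nbhs (conj oU Ux)) => y; exact: IH.
Qed.

End SmoothExt.

(* chart_inv is only significant on the image of dom. *)
Record chart (T : Type) (V : normedModType R) := Chart {
  dom : set T;
  chart_map : T -> V;
  chart_inv : V -> T;
  chart_mapK : forall x, dom x -> chart_inv (chart_map x) = x;
  chart_open : open (chart_map @` dom) }.

Record atlased (V : normedModType R) := Atlased {
  atl_sort : choiceType;
  atlas : set (chart atl_sort V);
  atlas_cover : forall x, exists2 c, atlas c & dom c x }.
Arguments atlas {V} _.

Definition points (V : normedModType R) (A : atlased V) : Type := atl_sort A.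

Section AtlasTopology.
Context {V : normedModType R} (A : atlased V).

HB.instance Definition _ := Choice.on (points A).

Definition atlas_open : set_system (points A) :=
  [set U | forall c, atlas A c -> open (chart_map c @` (dom c `&` U))].

Fact atlas_openT : atlas_open setT.
Proof. by move=> c _; rewrite setIT; exact: chart_open. Qed.

Fact atlas_openI : setI_closed atlas_open.
Proof.
move=> U W oU oW c cA.
rewrite (_ : _ @` _ = (chart_map c @` (dom c `&` U))
                      `&` (chart_map c @` (dom c `&` W))).
  by apply: openI; [exact: oU|exact: oW].
apply/seteqP; split=> v.
  by move=> [x [xc [xU xW]] <-]; split; exists x.
move=> [[x [xc xU] <-] [x' [x'c x'W] e]]; exists x => //.
split=> //; split=> //; by rewrite -(chart_mapK xc) -e chart_mapK.
Qed.

Fact atlas_open_bigU (I : Type) (f : I -> set (points A)) :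
  (forall i, atlas_open (f i)) -> atlas_open (\bigcup_i f i).
Proof.
move=> fo c cA.
rewrite (_ : _ @` _ = \bigcup_i (chart_map c @` (dom c `&` f i))).
  by apply: bigcup_open => i _; exact: fo.
apply/seteqP; split=> v.
  by move=> [x [xc [i _ xi]] <-]; exists i => //; exists x.
by move=> [i _ [x [xc xi] <-]]; exists x => //; split=> //; exists i.
Qed.

HB.instance Definition _ := isOpenTopological.Build (points A)
  atlas_openT atlas_openI atlas_open_bigU.

End AtlasTopology.

Coercion points : atlased >-> Sortclass.

Section Smoothness.
Context {V V' : normedModType R} (A : atlased V) (B : atlased V').

Definition smooth_fun (U : set A) (f : A -> R) : Prop :=
  forall c, atlas A c ->
    smooth_on (chart_map c @` (dom c `&` U)) (fun v => f (chart_inv c v) : R^o).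

Definition smooth_map (f : A -> B) : Prop :=
  continuous f /\
  forall c c', atlas A c -> atlas B c' ->
    smooth_on (chart_map c @` (dom c `&` f @^-1` dom c'))
      (fun v => chart_map c' (f (chart_inv c v))).

Definition is_manifold : Prop :=
  [/\ forall c c', atlas A c -> atlas A c' ->
        open (chart_map c @` (dom c `&` dom c')) /\
        smooth_on (chart_map c @` (dom c `&` dom c'))
          (fun v => chart_map c' (chart_inv c v)),
      hausdorff_space A & @second_countable A].

(* The directional derivative of f in the coordinates of c. *)
Definition pder (c : chart A V) (v : V) (f : A -> R) (x : A) : R :=
  'D_v (fun w => f (chart_inv c w) : R^o) (chart_map c x).

Definition pderivable (c : chart A V) (v : V) (f : A -> R) (x : A) : Prop :=
  derivable (fun w => f (chart_inv c w) : R^o) (chart_map c x) v.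

(* The tangent space at x is the model space V: a tangent vector is recorded by
   its components in the chart pref x of the atlas selected at x. *)
Definition pref (x : A) : chart A V := s2val (cid2 (atlas_cover x)).

(* The tangent vector at x with components v in the chart c. *)
Definition coord_vec (c : chart A V) (v : V) (x : A) : V :=
  'D_v (fun w => chart_map (pref x) (chart_inv c w)) (chart_map c x).

(* The components in the chart c of the tangent vector X at x. *)
Definition tcoord (c : chart A V) (x : A) (X : V) : V :=
  'D_X (fun w => chart_map c (chart_inv (pref x) w)) (chart_map (pref x) x).

End Smoothness.

Record manifold (m : nat) := Manifold {
  man_atlased :> atlased 'rV[R]_m;
  manifoldP : is_manifold man_atlased }.

Record diffeo (m : nat) (M N : manifold m) := Diffeo {
  diffeo_fun :> M -> N;
  diffeo_inv : N -> M;
  diffeo_funK : cancel diffeo_fun diffeo_inv;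
  diffeo_invK : cancel diffeo_inv diffeo_fun;
  diffeo_smooth : smooth_map diffeo_fun;
  diffeo_inv_smooth : smooth_map diffeo_inv }.

End Manifolds.
Arguments manifold R m : clear implicits.
Arguments atlas {R V} _ _.

Section Bundles.
Context {R : realType} {V : normedModType R}.

Record lframe (A : atlased V) (B : A -> vectType R) (r : nat) := LFrame {
  fdom : set A;
  fdom_open : open fdom;
  fvec : forall x, r.-tuple (B x);
  fvec_basis : forall x, fdom x -> basis_of fullv (fvec x) }.

(* The frames form a trivializing atlas, not assumed to be maximal; an arbitrary
   local frame is an lframe satisfying smooth_frame below. *)
Record vbundle (A : atlased V) (r : nat) := VBundle {
  fiber :> A -> vectType R;
  frames : set (lframe fiber r);
  frames_cover : forall x, exists2 s, frames s & fdom s x;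
  frames_smooth : forall s s' (a b : 'I_r), frames s -> frames s' ->
    smooth_fun (fdom s `&` fdom s')
      (fun x => coord (fvec s' x) b (fvec s x)`_a) }.
Arguments frames {A r} _.

Definition section (A : atlased V) (r : nat) (E : vbundle A r) : Type :=
  forall x : A, E x.

Definition smooth_section (A : atlased V) (r : nat) (E : vbundle A r)
    (U : set A) (u : section E) : Prop :=
  forall (s : lframe E r) (a : 'I_r), frames E s ->
    smooth_fun (U `&` fdom s) (fun x => coord (fvec s x) a (u x)).

Definition smooth_frame (A : atlased V) (r : nat) (E : vbundle A r)
    (s : lframe E r) : Prop :=
  forall a : 'I_r, smooth_section (fdom s) (fun x => (fvec s x)`_a : E x).

Section Dual.
Context {A : atlased V} {r : nat} (E : vbundle A r).

Definition dual_fiber (x : A) : vectType R := 'Hom(E x, R^o).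

Definition dual_tuple (s : lframe E r) (x : A) : r.-tuple (dual_fiber x) :=
  [tuple linfun (coord (fvec s x) a : {linear E x -> R^o}) | a < r].

Lemma dual_tupleE (s : lframe E r) (x : A) (a : 'I_r) (v : E x) :
  ((dual_tuple s x)`_a : 'Hom(E x, R^o)) v = coord (fvec s x) a v.
Proof. by rewrite -tnth_nth tnth_mktuple lfunE. Qed.

Fact dual_tuple_basis (s : lframe E r) (x : A) : fdom s x ->
  basis_of fullv (dual_tuple s x).
Proof.
move=> /fvec_basis sb; have sf := basis_free sb.
rewrite basisEfree subvf size_tuple; apply/and3P; split => //.
  apply/freeP => k k0 b.
  have := congr1 (fun l : 'Hom(E x, R^o) => l (fvec s x)`_b) k0.
  rewrite sum_lfunE zero_lfunE (bigD1 b) //= scale_lfunE.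
  rewrite (dual_tupleE s b) coord_free // eqxx big1 ?addr0 => [|a ab].
    by rewrite /GRing.scale /= mulr1.
  rewrite scale_lfunE (dual_tupleE s a) coord_free //.
  by rewrite eq_sym (negbTE ab) scaler0.
apply: leq_trans (dimvS _) (leq_trans (dim_span (dual_tuple s x)) _);
  last by rewrite size_tuple.
apply/subvP => l _.
rewrite (_ : l = \sum_(a < r) l (fvec s x)`_a *: (dual_tuple s x)`_a).
  by apply: memv_suml => a _; rewrite memvZ // memv_span // mem_nth ?size_tuple.
apply/lfunP => v; rewrite sum_lfunE.
rewrite [in LHS](coord_basis sb (memvf v)) linear_sum.
apply: eq_bigr => a _; rewrite linearZ scale_lfunE (dual_tupleE s a).
by rewrite /GRing.scale /= mulrC.
Qed.

Definition dual_lframe (s : lframe E r) : lframe dual_fiber r :=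
  LFrame (fdom_open s) (@dual_tuple_basis s).

Definition dual_frames : set (lframe dual_fiber r) :=
  [set t | exists2 s, frames E s & t = dual_lframe s].

Fact dual_frames_cover (x : A) : exists2 t, dual_frames t & fdom t x.
Proof.
by have [s sE sx] := frames_cover E x; exists (dual_lframe s) => //; exists s.
Qed.

Fact dual_frames_smooth (t t' : lframe dual_fiber r) (a b : 'I_r) :
  dual_frames t -> dual_frames t' ->
  smooth_fun (fdom t `&` fdom t')
    (fun x => coord (fvec t' x) b (fvec t x)`_a).
Proof.
move=> [s sE ->] [s' s'E ->] c cA.
have sm := frames_smooth b a s'E sE cA; rewrite (setIC (fdom s')) in sm.
apply: smooth_on_eq sm.
  exact: (openI (fdom_open s) (fdom_open s') : open (_ : set A)) c cA.
move=> _ [x [xc [sx s'x]] <-]; rewrite chart_mapK //=.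
have sb := fvec_basis s'x; have db := dual_tuple_basis s'x.
rewrite -(dual_tupleE s a).
move: (_`_a) => l; rewrite {1}(coord_basis db (memvf l)).
rewrite sum_lfunE (bigD1 b) //= scale_lfunE (dual_tupleE s' b).
rewrite coord_free ?(basis_free sb) // eqxx big1 ?addr0 => [|k kb].
  by rewrite /GRing.scale /= mulr1.
rewrite scale_lfunE (dual_tupleE s' k) coord_free ?(basis_free sb) //.
by rewrite eq_sym (negbTE kb) scaler0.
Qed.

Definition dual : vbundle A r :=
  VBundle dual_frames_cover dual_frames_smooth.

Definition dual_frame (s : lframe E r) : lframe dual r := dual_lframe s.

End Dual.
End Bundles.
Arguments frames {R V A r} _ _.

Section TotalSpace.
Context {R : realType} {m r : nat} {M : manifold R m} (E : vbundle M r).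

Section BundleChart.
Variables (c : chart M 'rV[R]_m) (cM : atlas M c) (s : lframe E r).

Definition total_dom : set {x : M & E x} :=
  [set e | (dom c `&` fdom s) (tag e)].

Definition total_map (e : {x : M & E x}) : 'rV[R]_m * 'rV[R]_r :=
  (chart_map c (tag e), \row_a coord (fvec s (tag e)) a (tagged e)).

Definition total_inv (v : 'rV[R]_m * 'rV[R]_r) : {x : M & E x} :=
  let x := chart_inv c v.1 in
  Tagged (fun x => E x) (\sum_(a < r) v.2 0 a *: (fvec s x)`_a).

Fact total_mapK (e : {x : M & E x}) :
  total_dom e -> total_inv (total_map e) = e.
Proof.
case: e => x v [/= xc xs]; rewrite /total_inv /total_map /= chart_mapK //.
congr (Tagged _ _); rewrite [RHS](coord_basis (fvec_basis xs) (memvf v)).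
by apply: eq_bigr => a _; rewrite mxE.
Qed.

Fact total_open : open (total_map @` total_dom).
Proof.
rewrite (_ : _ @` _ = fst @^-1` (chart_map c @` (dom c `&` fdom s))).
  apply: open_comp; last exact: (fdom_open s : open (_ : set M)) c cM.
  by move=> v _; exact: cvg_fst.
apply/seteqP; split=> [_ [e [ec es] <-]|[v y] [x [xc xs] /= <-]].
  by exists (tag e).
exists (Tagged (fun x => E x) (\sum_(a < r) y 0 a *: (fvec s x)`_a)) => //.
congr pair; apply/rowP => a; rewrite mxE /=.
by rewrite coord_sum_free // (basis_free (fvec_basis xs)).
Qed.

Definition bundle_chart : chart {x : M & E x} ('rV[R]_m * 'rV[R]_r)%type :=
  Chart total_mapK total_open.

End BundleChart.

Definition total_atlas : set (chart {x : M & E x} ('rV[R]_m * 'rV[R]_r)%type) :=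
  [set k | exists c (cM : atlas M c) s, frames E s /\ k = bundle_chart cM s].

Fact total_cover (e : {x : M & E x}) : exists2 k, total_atlas k & dom k e.
Proof.
have [c cM ce] := atlas_cover (tag e).
have [s sE se] := frames_cover E (tag e).
by exists (bundle_chart cM s) => //; exists c, cM, s.
Qed.

Definition total_space : atlased ('rV[R]_m * 'rV[R]_r)%type :=
  Atlased total_cover.

(* The coordinates (x^i, y^a). *)
Definition total_chart (c : chart M 'rV[R]_m) (cM : atlas M c)
    (s : lframe E r) : chart total_space ('rV[R]_m * 'rV[R]_r)%type :=
  bundle_chart cM s.

Definition base_pt (e : total_space) : M := tag e.

Definition fibre_vec (e : total_space) : E (base_pt e) := tagged e.

Definition at_point (x : M) (v : E x) : total_space := Tagged (fun x => E x) v.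

(* U^a, the fibre coordinate y^a. *)
Definition fibre_coord (s : lframe E r) (a : 'I_r) (e : total_space) : R :=
  coord (fvec s (base_pt e)) a (fibre_vec e).

Definition dx (i : 'I_m) : 'rV[R]_m * 'rV[R]_r := (delta_mx 0 i, 0).
Definition dy (a : 'I_r) : 'rV[R]_m * 'rV[R]_r := (0, delta_mx 0 a).

(* d^2 f / dy^a dy^b and d^2 f / dx^i dy^b *)
Definition hess (k : chart total_space ('rV[R]_m * 'rV[R]_r)%type)
    (f : total_space -> R) (a b : 'I_r) : total_space -> R :=
  pder k (dy a) (pder k (dy b) f).
Definition hess_mixed (k : chart total_space ('rV[R]_m * 'rV[R]_r)%type)
    (f : total_space -> R) (i : 'I_m) (b : 'I_r) : total_space -> R :=
  pder k (dx i) (pder k (dy b) f).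

(* A Lagrange fundamental function; on a dual bundle, a Hamilton one. *)
Definition fundamental (f : total_space -> R) : Prop :=
  (forall u : section E, smooth_section setT u -> (exists x, u x != 0) ->
     smooth_fun setT (fun x => f (at_point (u x)))) /\
  continuous (fun x : M => f (at_point (0 : E x)) : R^o).

Definition fibre_hess_exists (k : chart total_space ('rV[R]_m * 'rV[R]_r)%type)
    (f : total_space -> R) : Prop :=
  forall e, dom k e -> fibre_vec e != 0 -> forall b,
    pderivable k (dy b) f e /\
    forall a, pderivable k (dy a) (pder k (dy b) f) e.

Definition mixed_hess_exists (k : chart total_space ('rV[R]_m * 'rV[R]_r)%type)
    (f : total_space -> R) : Prop :=
  forall e, dom k e -> fibre_vec e != 0 -> forall i b,
    pderivable k (dx i) (pder k (dy b) f) e.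

End TotalSpace.

Section Morphisms.
Context {R : realType} {m p r : nat} {M N : manifold R m}.
Variables (h : diffeo M N) (E : vbundle M r) (F : vbundle N p).

Definition morph_coef (g : forall x, 'Hom(E x, F (h x)))
    (s : lframe E r) (t : lframe F p) (alpha : 'I_p) (b : 'I_r) (x : M) : R :=
  coord (fvec t (h x)) alpha (g x (fvec s x)`_b).

Record vb_morphism := VbMorphism {
  vbm_fun :> forall x, 'Hom(E x, F (h x));
  vbm_smooth : forall s t alpha b, frames E s -> frames F t ->
    smooth_fun (fdom s `&` h @^-1` fdom t) (morph_coef vbm_fun s t alpha b) }.

Definition locally_invertible (g : vb_morphism) : Prop :=
  forall x, lker (g x) = 0%VS /\ limg (g x) = fullv.

(* The matrix of the inverse of g x, i.e. the inverse matrix of morph_coef. *)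
Definition inv_coef (g : vb_morphism) (s : lframe E r) (t : lframe F p)
    (b : 'I_r) (alpha : 'I_p) (x : M) : R :=
  coord (fvec s x) b ((g x)^-1%VF (fvec t (h x))`_alpha).

(* (g^alpha_a u^a) t_alpha, with the components still functions on M *)
Definition morph_comp (g : vb_morphism) (s : lframe E r) (t : lframe F p)
    (u : section E) (alpha : 'I_p) (x : M) : R :=
  \sum_(a < r) morph_coef g s t alpha a x * coord (fvec s x) a (u x).

(* Gamma(g, h)(u) *)
Definition morph_section (g : vb_morphism) (s : lframe E r) (t : lframe F p)
    (u : section E) : section F :=
  fun y => \sum_(alpha < p)
    morph_comp g s t u alpha (diffeo_inv h y) *: (fvec t y)`_alpha.

End Morphisms.

Section Algebroid.
Context {R : realType} {m p : nat} {M N : manifold R m}.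
Variables (h : diffeo M N) (eta : diffeo N M) (F : vbundle N p).

(* rho y takes its values in the tangent space of M at eta y. *)
Definition anchor_coef (rho : forall y : N, 'Hom(F y, 'rV[R]_m))
    (c : chart M 'rV[R]_m) (t : lframe F p) (i : 'I_m) (alpha : 'I_p) (y : N) :
    R :=
  tcoord c (eta y) (rho y (fvec t y)`_alpha) 0 i.

(* Gamma(Th o rho, h o eta)(z)(f), in the coordinates x^i given by c *)
Definition anchor_deriv (rho : forall y : N, 'Hom(F y, 'rV[R]_m))
    (c : chart M 'rV[R]_m) (t : lframe F p) (z : section F) (f : N -> R)
    (y : N) : R :=
  \sum_(alpha < p) \sum_(i < m)
    coord (fvec t y) alpha (z y) * anchor_coef rho c t i alpha y *
    pder c (delta_mx 0 i) (f \o h) (diffeo_inv h y).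

(* When eta is not the inverse of h, the coordinate expression of the anchor
   mixes the points eta y and h^-1 y and depends on the chart; the Leibniz rule
   is required in the charts of the given atlas of M, which need not be
   maximal. *)
Record gen_lie_algebroid := GenLieAlgebroid {
  anchor : forall y : N, 'Hom(F y, 'rV[R]_m);
  anchor_smooth : forall c t i alpha, atlas M c -> frames F t ->
    smooth_fun (fdom t `&` eta @^-1` dom c) (anchor_coef anchor c t i alpha);
  bracket : section F -> section F -> section F;
  bracket_smooth : forall z w, smooth_section setT z -> smooth_section setT w ->
    smooth_section setT (bracket z w);
  bracket_linear : forall (k : R) z z' w,
    smooth_section setT z -> smooth_section setT z' ->
    smooth_section setT w ->
    forall y, bracket (fun x => k *: z x + z' x) w y =
      k *: bracket z w y + bracket z' w y;
  bracket_anti : forall z w,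
    smooth_section setT z -> smooth_section setT w ->
    forall y, bracket z w y = - bracket w z y;
  bracket_jacobi : forall z w v,
    smooth_section setT z -> smooth_section setT w ->
    smooth_section setT v ->
    forall y, bracket z (bracket w v) y + bracket w (bracket v z) y +
      bracket v (bracket z w) y = 0;
  bracket_leibniz : forall z w (f : N -> R),
    smooth_section setT z -> smooth_section setT w -> smooth_fun setT f ->
    forall c t y, atlas M c -> frames F t -> fdom t y ->
      dom c (diffeo_inv h y) -> dom c (eta y) ->
    bracket z (fun x => f x *: w x) y =
      f y *: bracket z w y + anchor_deriv anchor c t z f y *: w y }.

(* The bracket of sections defined near y, through global extensions of their
   germs at y. *)
Definition local_bracket (A : gen_lie_algebroid) (z w : section F) :
    section F :=
  fun y => xget 0 [set v | exists z' w' : section F,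
    [/\ smooth_section setT z', smooth_section setT w',
        \forall x \near y, z' x = z x, \forall x \near y, w' x = w x &
        v = bracket A z' w' y]].

Section Lifts.
Context {r : nat} (A : gen_lie_algebroid) (B : vbundle M r).
Variables (c : chart M 'rV[R]_m) (cM : atlas M c).
Variables (s : lframe B r) (t : lframe F p).

(* K^gamma_a(u) *)
Definition Kcoef (g : vb_morphism h B F) (u : section B) (gamma : 'I_p)
    (a : 'I_r) (y : N) : R :=
  coord (fvec t y) gamma
    (local_bracket A (morph_section g s t u)
       (morph_section g s t (fun x => (fvec s x)`_a)) y).

(* The fibre at e of (h o pi)^*F (+) TB, which contains (rho, eta)TB. *)
Definition prolong (e : total_space B) : lmodType R :=
  (F (h (base_pt e)) * ('rV[R]_m * 'rV[R]_r))%type.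

Definition tilde_d (alpha : 'I_p) (e : total_space B) : prolong e :=
  ((fvec t (h (base_pt e)))`_alpha,
   \sum_(i < m) anchor_coef (anchor A) c t i alpha (h (base_pt e)) *:
     coord_vec (total_chart cM s) (dx i) e).

Definition tilde_ddot (a : 'I_r) (e : total_space B) : prolong e :=
  (0, coord_vec (total_chart cM s) (dy a) e).

(* U^a (K^gamma_a(u) o h o pi) (gtilde^b_gamma o pi) *)
Definition lift_coef (g : vb_morphism h B F) (u : section B) (b : 'I_r)
    (e : total_space B) : R :=
  \sum_(a < r) \sum_(gamma < p)
    fibre_coord s a e * Kcoef g u gamma a (h (base_pt e)) *
    inv_coef g s t b gamma (base_pt e).

Definition complete_lift (g : vb_morphism h B F) (u : section B)
    (e : total_space B) : prolong e :=
  \sum_(alpha < p) morph_comp g s t u alpha (base_pt e) *: tilde_d alpha e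
  - \sum_(b < r) lift_coef g u b e *: tilde_ddot b e.

(* The components of an element of (rho, eta)TB in its local frame. *)
Definition prolong_comp (e : total_space B) (X : prolong e) :
    'rV[R]_p * 'rV[R]_r :=
  xget (0 : 'rV[R]_p * 'rV[R]_r)
    [set zy : 'rV[R]_p * 'rV[R]_r | X =
       \sum_(alpha < p) zy.1 0 alpha *: tilde_d alpha e
       + \sum_(a < r) zy.2 0 a *: tilde_ddot a e].

End Lifts.
End Algebroid.

Section Legendre.
Context {R : realType} {m r : nat} {M : manifold R m} (E : vbundle M r).

Section Morphism.
Variables (c : chart M 'rV[R]_m) (cM : atlas M c) (s : lframe E r).

(* The result does not depend on the chart and frame used to write it. *)
Definition phiL (L : total_space E -> R) (e : total_space E) :
    total_space (dual E) :=
  at_point (\sum_(b < r)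
    (\sum_(a < r) fibre_coord s a e * hess (total_chart cM s) L a b e) *:
    (fvec (dual_frame s) (base_pt e))`_b : dual E (base_pt e)).

(* Gamma(phi_H, Id_M)(us); H^{ab} is evaluated at the point us x. *)
Definition phiH_section (H : total_space (dual E) -> R)
    (us : section (dual E)) : section E :=
  fun x => \sum_(b < r)
    (\sum_(a < r) coord (fvec (dual_frame s) x) a (us x) *
       hess (total_chart cM (dual_frame s)) H a b (at_point (us x))) *:
    (fvec s x)`_b.

End Morphism.

Definition legendre_transform (L : total_space E -> R)
    (H : total_space (dual E) -> R) : Prop :=
  forall c (cM : atlas M c) (s : lframe E r), smooth_frame s ->
  forall (x : M) (us : dual E x) (u : E x),
    dom c x -> fdom s x -> u != 0 ->
    (forall b, coord (fvec (dual_frame s) x) b us =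
       \sum_(a < r) coord (fvec s x) a u *
         hess (total_chart cM s) L a b (at_point u)) ->
    H (at_point us) =
      \sum_(a < r) coord (fvec (dual_frame s) x) a us * coord (fvec s x) a u
      - L (at_point u).

End Legendre.

Section TangentApplication.
Context {R : realType} {m p r : nat} {M N : manifold R m}.
Context {h : diffeo M N} {eta : diffeo N M} {F : vbundle N p}.
Variables (A : gen_lie_algebroid h eta F) (E : vbundle M r).
Variables (c : chart M 'rV[R]_m) (cM : atlas M c).
Variables (s : lframe E r) (t : lframe F p).
Variables (L : total_space E -> R) (H : total_space (dual E) -> R).

(* Gamma((rho, eta)T phi_H, phi_H), on sections of (rho, eta)TE^* *)
(* X is decomposed at phi_L(e) into its components (Z, Y), so that e |-> zy.1
   and e |-> zy.2 are Z o phi_L and Y o phi_L. *)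
Definition tangent_phiH
    (X : forall e : total_space (dual E), prolong h F e) (e : total_space E) :
    prolong h F e :=
  let es := phiL cM s L e in
  let zy := prolong_comp A cM (dual_frame s) t (X es) in
  \sum_(alpha < p) zy.1 0 alpha *: tilde_d A cM s t alpha e
  + \sum_(b < r)
      (\sum_(alpha < p) \sum_(i < m)
         anchor_coef eta (anchor A) c t i alpha (h (base_pt es)) *
         zy.1 0 alpha *
         hess_mixed (total_chart cM (dual_frame s)) H i b es) *:
      tilde_ddot h F cM s b e
  + \sum_(b < r)
      (\sum_(a < r) zy.2 0 a *
         hess (total_chart cM (dual_frame s)) H a b es) *:
      tilde_ddot h F cM s b e.

End TangentApplication.

(* The points e of E at which all the functions involved are defined: the
   coordinates and frames at e, the second derivatives of L at e and those of H
   at phi_L(e) and along us (all off the zero section), and the brackets of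
   u = Gamma(phi_H, Id_M)(us), which have to be taken where u is smooth. *)
Definition legendre_dom {R : realType} {m p r : nat} {M N : manifold R m}
    (h : diffeo M N) (eta : diffeo N M) {F : vbundle N p} {E : vbundle M r}
    (c : chart M 'rV[R]_m) (cM : atlas M c) (s : lframe E r) (t : lframe F p)
    (L : total_space E -> R) (H : total_space (dual E) -> R)
    (us : section (dual E)) : set (total_space E) :=
  [set e | [/\ dom c (base_pt e) /\ dom c (eta (h (base_pt e))),
               fdom s (base_pt e) /\ fdom t (h (base_pt e)),
               fibre_vec e != 0 /\ fibre_vec (phiL cM s L e) != 0,
               us (base_pt e) != 0 &
               exists U : set M, [/\ open U, U (base_pt e) &
                 smooth_section U (phiH_section cM s H us)]]].

(* Main.v *)
Require Import Defs.
From mathcomp Require Import all_boot all_order all_algebra.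
From mathcomp Require Import all_classical all_reals all_analysis.

Set Implicit Arguments.
Unset Strict Implicit.
Unset Printing Implicit Defensive.

Import Order.TTheory GRing.Theory Num.Theory.
Import numFieldNormedType.Exports.

Local Open Scope classical_set_scope.
Local Open Scope ring_scope.

(** The two identities are the horizontal and the vertical components of the
    hypothesis, so everything rests on [tilde_d], [tilde_ddot] being a frame:
    an element of the prolongation determines its components
    ([tilde_frame_inj]). This is used twice. On the dual bundle it identifies
    the components (Z, Y) from which the tangent application of phi_H is
    computed: for a complete lift they are the coefficients of that lift
    ([prolong_compE]), which gives the image of the complete lift explicitly
    ([tangent_phiH_complete_lift]). On the bundle itself it allows the
    comparison of the coefficients of this image with those of the complete
    lift of u.

    Independence of the horizontal fields is read off their components in F.
    That of the vertical fields needs the tangent vectors d/dy^a in the chart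
    selected at the point: along a fibre a change of bundle charts is linear,
    with matrix the change of frames, so its difference quotients are constant
    and d/dy^a is given by a row of this invertible matrix ([coord_vec_dy]). *)

Section VerticalVectors.
Context {R : realType} {m r : nat} {M : manifold R m} {B : vbundle M r}.
Context {c : chart M 'rV[R]_m} (cM : atlas M c) (s : lframe B r).

(** Moving in the direction y^a keeps the base point and adds a multiple of
    s_a to the fibre vector, so the coordinates in another bundle chart, with
    frame s', change by the same multiple of the components of s_a in s'. *)
Lemma coord_vec_dy (e : total_space B) : dom c (base_pt e) ->
  exists2 s' : lframe B r, fdom s' (base_pt e) &
    forall a, coord_vec (total_chart cM s) (dy a) e =
      (0, \row_b coord (fvec s' (base_pt e)) b (fvec s (base_pt e))`_a).
Proof.
case: e => x v /= cx; rewrite /coord_vec /pref.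
case: cid2 => /= k [c' [c'M [s' [_ ->]]]] [_ /= s'x].
exists s' => // a; apply: norm_lim_near_cst.
near=> l; have l0 : l != 0 by near: l; exact: nbhs_dnbhs_neq.
rewrite /= /total_inv /total_map /= scaler0 add0r chart_mapK //.
rewrite [LHS]surjective_pairing; congr pair; first by rewrite /= subrr scaler0.
apply/rowP => b; rewrite /= !mxE. rewrite -linearB -sumrB /= (bigD1 a) //=.
rewrite big1 ?addr0 => [|i ia].
  by rewrite -scalerBl !mxE !eqxx mulr1 addrK linearZ /= mulrA mulVf // mul1r.
by rewrite -scalerBl !mxE eqxx (negbTE ia) mulr0 add0r subrr scale0r.
Unshelve. all: by end_near. Qed.

Lemma coord_vec_dy_free (e : total_space B) (y : 'I_r -> R) :
  dom c (base_pt e) -> fdom s (base_pt e) ->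
  \sum_a y a *: coord_vec (total_chart cM s) (dy a) e = 0 ->
  forall a, y a = 0.
Proof.
move=> ce se; have [s' s'e sE] := coord_vec_dy ce.
move=> /(congr1 snd); rewrite raddf_sum /= => y0.
apply: (freeP (basis_free (fvec_basis se))).
rewrite [LHS](coord_basis (fvec_basis s'e) (memvf _)) big1 // => b _.
have /rowP/(_ b) := y0; rewrite summxE mxE => yb.
suff -> : coord (fvec s' (base_pt e)) b
    (\sum_(i < r) y i *: (fvec s (base_pt e))`_i) = 0 by rewrite scale0r.
rewrite linear_sum -[RHS]yb; apply: eq_bigr => a _.
by rewrite sE /= linearZ !mxE.
Qed.

End VerticalVectors.

Section ProlongationFrame.
Context {R : realType} {m p r : nat} {M N : manifold R m}.
Context {h : diffeo M N} {eta : diffeo N M} {F : vbundle N p}.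
Context (A : gen_lie_algebroid h eta F) {B : vbundle M r}.
Context {c : chart M 'rV[R]_m} (cM : atlas M c).
Context (s : lframe B r) (t : lframe F p).

Definition prolong_vec (e : total_space B) (z : 'I_p -> R) (y : 'I_r -> R) :
    prolong h F e :=
  \sum_(alpha < p) z alpha *: tilde_d A cM s t alpha e
  + \sum_(a < r) y a *: tilde_ddot h F cM s a e.

Lemma prolong_vecB (e : total_space B) z z' y y' :
  prolong_vec e z y - prolong_vec e z' y' =
  prolong_vec e (fun i => z i - z' i) (fun a => y a - y' a).
Proof.
rewrite /prolong_vec opprD addrACA -!sumrB.
by congr (_ + _); apply: eq_bigr => i _; rewrite scalerBl.
Qed.

(** The component in F sees the horizontal coefficients alone; once these
    vanish, the tangent component sees the vertical ones. *)
Lemma prolong_vec_eq0 (e : total_space B) z y :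
  dom c (base_pt e) -> fdom s (base_pt e) -> fdom t (h (base_pt e)) ->
  prolong_vec e z y = 0 -> (forall i, z i = 0) /\ (forall a, y a = 0).
Proof.
move=> ce se te zy0.
have z0 i : z i = 0.
  apply: (freeP (basis_free (fvec_basis te))).
  have /(congr1 fst) := zy0; rewrite /prolong_vec /= !raddf_sum /=.
  by rewrite [X in _ + X]big1 ?addr0 // => a _; rewrite scaler0.
split=> //; apply: (coord_vec_dy_free (cM := cM) ce se).
have /(congr1 snd) := zy0; rewrite /prolong_vec /= !raddf_sum /=.
by rewrite [X in X + _]big1 ?add0r // => i _; rewrite z0 scale0r.
Qed.

Lemma tilde_frame_inj (e : total_space B) z z' y y' :
  dom c (base_pt e) -> fdom s (base_pt e) -> fdom t (h (base_pt e)) ->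
  prolong_vec e z y = prolong_vec e z' y' -> z =1 z' /\ y =1 y'.
Proof.
move=> ce se te /eqP; rewrite -subr_eq0 prolong_vecB => /eqP.
by case/prolong_vec_eq0 => // zz yy; split=> i; apply: subr0_eq.
Qed.

Lemma prolong_compE (e : total_space B) z y :
  dom c (base_pt e) -> fdom s (base_pt e) -> fdom t (h (base_pt e)) ->
  prolong_comp A cM s t (prolong_vec e z y) = (\row_i z i, \row_a y a).
Proof.
move=> ce se te; apply: xget_unique => [|[z' y']] /=.
  by congr (_ + _); apply: eq_bigr => i _; rewrite mxE.
by case/tilde_frame_inj => // zz yy; congr pair; apply/rowP => i; rewrite mxE.
Qed.

Lemma complete_liftE (g : vb_morphism h B F) (u : section B) e :
  complete_lift A cM s t g u e =
  prolong_vec e (fun alpha => morph_comp g s t u alpha (base_pt e))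
    (fun b => - lift_coef A s t g u b e).
Proof.
rewrite /complete_lift /prolong_vec -sumrN; congr (_ + _).
by apply: eq_bigr => b _; rewrite scaleNr.
Qed.

End ProlongationFrame.

(** At phi_L(e) the components of the complete lift are its coefficients, to
    which the formulas of the tangent application apply directly. *)
Lemma tangent_phiH_complete_lift (R : realType) (m p r : nat)
    (M N : manifold R m) (h : diffeo M N) (eta : diffeo N M) (F : vbundle N p)
    (A : gen_lie_algebroid h eta F) (E : vbundle M r)
    (gs : vb_morphism h (dual E) F) (L : total_space E -> R)
    (H : total_space (dual E) -> R) (c : chart M 'rV[R]_m) (cM : atlas M c)
    (s : lframe E r) (t : lframe F p) (us : section (dual E))
    (e : total_space E) :
  let ss := dual_frame s in
  let es := phiL cM s L e in
  dom c (base_pt e) -> fdom s (base_pt e) -> fdom t (h (base_pt e)) ->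
  tangent_phiH A cM s t L H (complete_lift A cM ss t gs us) e =
  prolong_vec A cM s t e
    (fun alpha => morph_comp gs ss t us alpha (base_pt es))
    (fun b => \sum_(alpha < p) \sum_(i < m)
       anchor_coef eta (anchor A) c t i alpha (h (base_pt es)) *
       morph_comp gs ss t us alpha (base_pt es) *
       hess_mixed (total_chart cM ss) H i b es
     - \sum_(k < r) lift_coef A ss t gs us k es *
         hess (total_chart cM ss) H k b es).
Proof.
move=> ss es ce se te.
rewrite /tangent_phiH complete_liftE prolong_compE //= /prolong_vec -addrA.
rewrite -big_split /=; congr (_ + _); apply: eq_bigr => b _; rewrite ?mxE //.
rewrite -scalerDl -sumrN; congr ((_ + _) *: _).
  by apply: eq_bigr => alpha _; apply: eq_bigr => i _; rewrite mxE.
by apply: eq_bigr => k _; rewrite mxE mulNr.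
Qed.

Theorem theorem53 (R : realType) (m p r : nat) (M N : manifold R m)
  (h : diffeo M N) (eta : diffeo N M) (F : vbundle N p)
  (A : gen_lie_algebroid h eta F) (E : vbundle M r)
  (g : vb_morphism h E F) (gs : vb_morphism h (dual E) F)
  (g_inv : locally_invertible g) (gs_inv : locally_invertible gs)
  (L : total_space E -> R) (H : total_space (dual E) -> R)
  (L_fund : fundamental L) (H_fund : fundamental H)
  (LH : legendre_transform L H)
  (c : chart M 'rV[R]_m) (cM : atlas M c)
  (s : lframe E r) (s_smooth : smooth_frame s)
  (t : lframe F p) (t_smooth : smooth_frame t)
  (L_hess : fibre_hess_exists (total_chart cM s) L)
  (H_hess : fibre_hess_exists (total_chart cM (dual_frame s)) H)
  (H_mixed : mixed_hess_exists (total_chart cM (dual_frame s)) H)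
  (us : section (dual E)) (us_smooth : smooth_section setT us) :
  let ss := dual_frame s in
  let u := phiH_section cM s H us in
  let phi := phiL cM s L in
  let D := legendre_dom h eta cM s t L H us in
  (forall e, D e ->
     tangent_phiH A cM s t L H (complete_lift A cM ss t gs us) e =
     complete_lift A cM s t g u e) ->
  (forall e, D e -> forall alpha : 'I_p,
     morph_comp g s t u alpha (base_pt e) =
     morph_comp gs ss t us alpha (base_pt (phi e))) /\
  (forall e, D e -> forall b : 'I_r,
     lift_coef A s t g u b e =
     (\sum_(k < r) lift_coef A ss t gs us k (phi e) *
        hess (total_chart cM ss) H k b (phi e))
     - \sum_(alpha < p) \sum_(i < m)
         anchor_coef eta (anchor A) c t i alpha (h (base_pt (phi e))) *
         morph_comp g s t u alpha (base_pt (phi e)) *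
         hess_mixed (total_chart cM ss) H i b (phi e)).
Proof.
move=> ss u phi D TC.
have comps e : D e ->
    (forall alpha, morph_comp g s t u alpha (base_pt e) =
       morph_comp gs ss t us alpha (base_pt (phi e))) /\
    (forall b, lift_coef A s t g u b e =
       (\sum_(k < r) lift_coef A ss t gs us k (phi e) *
          hess (total_chart cM ss) H k b (phi e))
       - \sum_(alpha < p) \sum_(i < m)
           anchor_coef eta (anchor A) c t i alpha (h (base_pt (phi e))) *
           morph_comp gs ss t us alpha (base_pt (phi e)) *
           hess_mixed (total_chart cM ss) H i b (phi e)).
  move=> De; have [[ce _] [se te] _ _ _] := De; have := TC e De.
  rewrite tangent_phiH_complete_lift // complete_liftE.
  case/tilde_frame_inj => // ZE YE; split=> [alpha|b]; first by rewrite ZE.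
  by rewrite -[LHS]opprK -YE opprB.
split=> e De; first by case: (comps e De).
have [ZE YE] := comps e De => b; rewrite YE; congr (_ - _).
(* phi covers the identity, so that ZE also holds at the base point of phi e *)
by apply: eq_bigr => alpha _; apply: eq_bigr => i _; rewrite -ZE.
Qed.
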